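(* For each integer $m \geq 3$ and each integer $n \geq 0$, there exist a self dual $\{2m-1, 2m-1\}$-equivelar polyhedral map with exactly $2(3^{m-1} + 2n - 1)$ vertices, and a self dual $\{2m, 2m\}$-equivelar polyhedral map with exactly $3^m + 2n - 1$ vertices.
   Context: A cycle is a finite connected $2$-regular (simple) graph; $(v_1,\dots,v_m)$ denotes the cycle with vertices $v_1,\dots,v_m$ and edges $v_1v_2,\dots,v_{m-1}v_m,v_mv_1$; an $m$-cycle is a cycle with $m$ vertices. A polyhedral complex (of dimension 2) $K$ is a collection of cycles (called its faces), together with the edges and vertices in these cycles, such that the intersection of any two distinct cycles is empty, a single vertex, or a single edge (with its end-vertices). $V(K)$ is its vertex-set and $\mathrm{EG}(K)$ is the graph formed by its vertices and edges. $K$ is finite if $V(K)$ is finite and connected if $\mathrm{EG}(K)$ is connected. A polyhedral $2$-manifold is a polyhedral complex such that for each vertex $v$ the faces containing $v$ are of the form $F_1,\dots,F_m$ (distinct) for some $m\ge 3$, where $F_1\cap F_2,\dots,F_{m-1}\cap F_m,F_m\cap F_1$ are ($m$ distinct) edges; i.e. the faces through $v$ form a single cycle of adjacent faces. A polyhedral map is a connected finite polyhedral $2$-manifold. A polyhedral map is $\{p,q\}$-equivelar if each face is a $p$-cycle and each vertex is in exactly $q$ faces. An isomorphism between polyhedral complexes $K$ and $L$ is a bijection $\varphi: V(K)\to V(L)$ such that $(v_1,\dots,v_m)$ is a face of $K$ if and only if $(\varphi(v_1),\dots,\varphi(v_m))$ is a face of $L$. The dual $\widetilde K$ of a polyhedral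 $2$-manifold $K$ is the polyhedral $2$-manifold whose vertices are the faces of $K$, where $(F_1,\dots,F_m)$ is a face of $\widetilde K$ if $F_1,\dots,F_m$ have a common vertex in $K$ and are the faces containing it, cyclically ordered so that $F_1\cap F_2,\dots,F_{m-1}\cap F_m,F_m\cap F_1$ are edges. $K$ is self dual if $\widetilde K$ is isomorphic to $K$. *)

(* Defs.v *)
From mathcomp Require Import all_boot.
From mathcomp Require Import boolp.

Set Implicit Arguments.
Unset Strict Implicit.
Unset Printing Implicit Defensive.

(** Graphs and complexes live in an ambient finite type [T], not all of whose
    elements need be vertices.  Only finite complexes are thus represented,
    which is all that polyhedral maps require. *)

(** A graph is a pair (vertex set, edge set). *)
Notation graph T := ({set T} * {set {set T}})%type.

Section Graphs.
Variable T : finType.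
Implicit Type G H : graph T.

Definition simple_graph G : Prop :=
  forall e, e \in G.2 -> e \subset G.1 /\ #|e| = 2.

Definition two_regular G : Prop :=
  forall x, x \in G.1 -> #|[set e in G.2 | x \in e]| = 2.

Definition adjacent G : rel T := fun x y => [set x; y] \in G.2.

Definition connected_graph G : Prop :=
  G.1 != set0 /\ forall x y, x \in G.1 -> y \in G.1 -> connect (adjacent G) x y.

Definition is_cycle G : Prop :=
  [/\ simple_graph G, two_regular G & connected_graph G].

(** The cycle (v_1, ..., v_m), where [s] lists v_1, ..., v_m; meaningful when
    [s] is duplicate-free and m >= 3. *)
Definition cycle_of (s : seq T) : graph T :=
  ([set x in s], [set [set x; next s x] | x in s]).

Definition graphI G H : graph T := (G.1 :&: H.1, G.2 :&: H.2).

Definition empty_graph : graph T := (set0, set0).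

Definition is_single_vertex G : Prop := exists x, G = ([set x], set0).

Definition is_single_edge G : Prop :=
  exists x y, x != y /\ G = ([set x; y], [set [set x; y]]).

End Graphs.

(** A complex is given by its set of faces; its vertices and edges are those
    of the faces. *)
Notation complex T := {set graph T}.

Section Complexes.
Variable T : finType.
Implicit Type K : complex T.

Definition vertices K : {set T} := \bigcup_(F in K) F.1.
Definition edges K : {set {set T}} := \bigcup_(F in K) F.2.
Definition edge_graph K : graph T := (vertices K, edges K).

Definition faces_at K (v : T) : {set graph T} := [set F in K | v \in F.1].

Definition polyhedral_complex K : Prop :=
  (forall F, F \in K -> is_cycle F) /\
  (forall F G, F \in K -> G \in K -> F != G ->
    [\/ graphI F G = empty_graph T,
        is_single_vertex (graphI F G) | is_single_edge (graphI F G)]).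

(** [s] lists without repetition the faces containing [v], cyclically ordered
    so that consecutive faces meet in an edge. *)
Definition cyclic_face_order K (v : T) (s : seq (graph T)) : Prop :=
  [/\ uniq s, s =i faces_at K v &
      forall F, F \in s -> is_single_edge (graphI F (next s F))].

Definition polyhedral_manifold K : Prop :=
  polyhedral_complex K /\
  forall v, v \in vertices K -> exists s : seq (graph T),
    [/\ 3 <= size s, cyclic_face_order K v s
      & uniq [seq graphI F (next s F) | F <- s]].

Definition polyhedral_map K : Prop :=
  polyhedral_manifold K /\ connected_graph (edge_graph K).

Definition equivelar (p q : nat) K : Prop :=
  (forall F, F \in K -> #|F.1| = p) /\
  (forall v, v \in vertices K -> #|faces_at K v| = q).

Definition dual K : complex (graph T) :=
  [set C | `[< exists v (s : seq (graph T)),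
    [/\ v \in vertices K, cyclic_face_order K v s & C = cycle_of s] >]].

End Complexes.

(** The bijection of vertex sets is given as a map between the ambient types,
    whose values outside [vertices K] are irrelevant. *)
Definition isomorphic (T T' : finType) (K : complex T) (L : complex T') : Prop :=
  exists f : T -> T',
    [/\ {in vertices K &, injective f}, f @: vertices K = vertices L &
        forall s : seq T, uniq s -> 3 <= size s -> {subset s <= vertices K} ->
          (cycle_of s \in K <-> cycle_of (map f s) \in L)].

Definition self_dual (T : finType) (K : complex T) : Prop :=
  isomorphic (dual K) K.

(* Main.v *)
(** Vertices and faces are both indexed by a cyclic group [Z_N], the vertex [v]
    lying on the face [f] iff [v + f] belongs to a fixed cyclic sequence
    [P = (p_0, p_1, ...)].  The symmetry of this incidence relation is a
    polarity, whence self-duality.  Consecutive faces at a vertex share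
    an edge as soon as every difference of consecutive terms of [P] occurs a
    second time as a difference in [P], and any two faces share no more than a
    vertex or an edge provided
    [a + e = b + c] in [P] forces [a] and [c] to be neighbours unless
    [{a, e} = {b, c}].

    Both hold for partial sums of doubled gaps [d_0, d_0, d_1, d_1, ...] where
    each [d_s] exceeds the sum of all gaps before it.  With [S] the sum of the
    first [2m] gaps, the [2m] terms [p_0, ..., p_(2m-1)] modulo [N = S] give
    [2m]-gons, and the [2m+1] terms [p_0, ..., p_(2m)] modulo [N = 2 S] give
    [(2m+1)]-gons, whose closing edge is the element [S] of order two.
    Powers of 3, the last one increased by [n], give the vertex counts. *)

Require Import Defs.
From mathcomp Require Import all_boot all_algebra zify.
From mathcomp Require Import boolp.
Import GRing.Theory.

Set Implicit Arguments.
Unset Strict Implicit.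
Unset Printing Implicit Defensive.

(** * Cyclic sequences and the cycles they define *)

Section CyclicSequences.
Variable T : finType.
Implicit Types (s : seq T) (x y z : T).

Lemma iter_next_neq s x k :
  uniq s -> x \in s -> 0 < k < size s -> iter k (next s) x != x.
Proof.
move=> Us xs /andP[k0 ks]; apply/eqP => Ek.
have ko : k < order (next s) x by rewrite (order_cycle (cycle_next Us) Us xs).
by move: (findex_iter ko) k0; rewrite Ek findex0 => <-.
Qed.

Lemma next_neq s x : uniq s -> 1 < size s -> x \in s -> next s x != x.
Proof. by move=> Us s1 xs; apply: (@iter_next_neq s x 1). Qed.

Definition neighbors s : rel T := fun x y => (next s x == y) || (next s y == x).

(** Orient each pair along [next s]. A cyclic orientation returns to [x] after three steps, and any
    other gives two distinct terms the same successor; the size of [s] and the injectivity of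
    [next s] exclude these. *)
Lemma neighbors_triangle s x y z : uniq s -> 3 < size s -> x \in s ->
  x != y -> y != z -> x != z ->
  neighbors s x y -> neighbors s y z -> neighbors s x z -> False.
Proof.
move=> Us s4 xs xy yz xz.
have ninj := can_inj (prev_next Us).
have n3 w : w \in s -> next s (next s (next s w)) != w.
  by move=> ws; apply: (@iter_next_neq s w 3).
have E u v w : next s u = v -> next s w = v -> u = w.
  by move=> <- /ninj.
case/orP=> /eqP E1; case/orP=> /eqP E2; case/orP=> /eqP E3;
  try (by move: (n3 x xs); rewrite ?E1 ?E2 ?E3 ?E2 ?E1 eqxx);
  move: xy yz xz; rewrite ?(E _ _ _ E1 E2) ?(E _ _ _ E1 E3) ?(E _ _ _ E2 E3) ?eqxx //;
  by rewrite -1?E1 -1?E2 -1?E3 ?eqxx.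
Qed.

(** Two terms with the same edge would be each other's successors, so [next s] would return after
    two steps. *)
Lemma cycle_of_inj_edge s : uniq s -> 2 < size s ->
  {in s &, injective (fun x => [set x; next s x])}.
Proof.
move=> Us s3 x y xs ys E; apply/eqP/negPn/negP => xy.
have : x \in [set y; next s y] by rewrite -E set21.
rewrite !inE (negPf xy) /= => /eqP Ex.
have : y \in [set x; next s x] by rewrite E set21.
rewrite !inE eq_sym (negPf xy) /= => /eqP Ey.
by have := @iter_next_neq s x 2 Us xs s3; rewrite /= -Ey -Ex eqxx.
Qed.

Lemma card_cycle_of_edges s : uniq s -> 2 < size s -> #|(cycle_of s).2| = size s.
Proof.
move=> Us s3; rewrite card_in_imset; first by apply/card_uniqP.
by move=> x y xs ys; apply: cycle_of_inj_edge.
Qed.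

Lemma cycle_of_edge s x y : x \in s -> y \in s ->
  neighbors s x y -> [set x; y] \in (cycle_of s).2.
Proof.
move=> xs ys /orP[] /eqP <-; first by apply: imset_f.
by rewrite setUC; apply: imset_f.
Qed.

Lemma is_cycle_cycle_of s : uniq s -> 2 < size s -> is_cycle (cycle_of s).
Proof.
move=> Us s3; split.
- move=> e /imsetP[x xs ->]; split.
    apply/subsetP=> y; rewrite !inE => /orP[/eqP-> //|/eqP->].
    by rewrite mem_next.
  rewrite cards2 eq_sym.
  by rewrite next_neq //; apply: ltnW.
- move=> x; rewrite inE => xs.
  suff -> : [set e in (cycle_of s).2 | x \in e]
      = [set [set x; next s x]; [set prev s x; x]].
    rewrite cards2; case: eqP => // E.
    have ps : prev s x \in s by rewrite mem_prev.
    have E' : [set x; next s x] = [set prev s x; next s (prev s x)].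
      by rewrite (next_prev Us).
    have := cycle_of_inj_edge Us s3 xs ps E'.
    move=> Ep; have := next_neq Us (ltnW s3) xs.
    by rewrite {1}Ep (next_prev Us) eqxx.
  apply/setP=> e; rewrite !inE; apply/andP/orP.
    case=> /imsetP[y ys ->]; rewrite !inE => /orP[]/eqP->.
      by left.
    by right; rewrite (prev_next Us).
  case=> /eqP->; rewrite !inE eqxx ?orbT; split=> //.
    by apply: imset_f.
  by apply/imsetP; exists (prev s x); rewrite ?mem_prev ?(next_prev Us).
- split.
    case: s s3 {Us} => // x s _; apply/set0Pn; exists x.
    by rewrite inE mem_head.
  move=> x y; rewrite !inE => xs ys.
  have: fconnect (next s) x y by rewrite (fconnect_cycle (cycle_next Us) xs).
  apply: connect_sub => u v /eqP <-.
  have [us|us] := boolP (u \in s).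
    by apply: connect1; apply: imset_f.
  by rewrite next_nth (negPf us).
Qed.

End CyclicSequences.

Lemma cycle_of_map (T T' : finType) (h : T -> T') (s : seq T) :
  injective h -> uniq s -> cycle_of (map h s) =
    (h @: (cycle_of s).1, [set h @: (e : {set T}) | e in (cycle_of s).2]).
Proof.
move=> hI Us; rewrite /cycle_of /=; congr pair; apply/setP => e.
  by rewrite inE; apply/mapP/imsetP => -[x xs ->]; exists x; rewrite ?inE // in xs *.
apply/imsetP/imsetP => [[_ /mapP[x xs ->] ->]|[_ /imsetP[x xs ->] ->]].
  exists [set x; next s x]; first exact: imset_f.
  by rewrite imsetU1 imset_set1 next_map.
exists (h x); first exact: map_f.
by rewrite imsetU1 imset_set1 next_map.
Qed.

Lemma cycle_of_map_inj (T T' : finType) (h : T -> T') (s t : seq T) :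
  injective h -> uniq s -> uniq t ->
  cycle_of (map h s) = cycle_of (map h t) -> cycle_of s = cycle_of t.
Proof.
move=> hI Us Ut; rewrite !cycle_of_map // => -[E1 E2].
rewrite [LHS]surjective_pairing [RHS]surjective_pairing.
by congr (_, _); [apply: (imset_inj hI) | apply: (imset_inj (imset_inj hI))].
Qed.

(** * Intersections of simple graphs *)

Section GraphIntersection.
Variable T : finType.
Implicit Types G H : graph T.

Lemma graphI_edge_sub G H e : simple_graph G -> simple_graph H ->
  e \in G.2 :&: H.2 -> e \subset G.1 :&: H.1 /\ #|e| = 2.
Proof.
move=> sG sH; rewrite inE => /andP[/sG[eG e2] /sH[eH _]].
by rewrite subsetI eG eH.
Qed.

Lemma graphI_le1 G H : simple_graph G -> simple_graph H ->
  #|G.1 :&: H.1| <= 1 -> graphI G H = (G.1 :&: H.1, set0).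
Proof.
move=> sG sH le1; congr (_, _); apply/setP=> e; rewrite in_set0.
apply/negP=> /(graphI_edge_sub sG sH)[/subset_leq_card + e2].
by rewrite e2 => /leq_trans/(_ le1).
Qed.

Lemma graphI_single_edge G H x y : simple_graph G -> simple_graph H ->
  x != y -> G.1 :&: H.1 = [set x; y] ->
  [set x; y] \in G.2 -> [set x; y] \in H.2 -> is_single_edge (graphI G H).
Proof.
move=> sG sH xy E xyG xyH; exists x, y; split=> //; congr (_, _) => //.
apply/setP=> e; rewrite in_set1; apply/idP/eqP => [|->]; last by rewrite inE xyG.
case/(graphI_edge_sub sG sH); rewrite E => es e2.
by apply/eqP; rewrite eqEcard es e2 cards2 xy.
Qed.

End GraphIntersection.

(** * Polyhedral maps from a sequence in a finite abelian group *)

Section TranslationMap.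
Local Open Scope ring_scope.
Variables (T : finZmodType) (P : seq T).

(* The indexing [p - f], rather than [p + f], makes incidence symmetric:
   [v] lies on the face [f] iff [v + f \in P], so that exchanging vertices and
   faces is a duality. *)
Definition face_seq (f : T) : seq T := [seq p - f | p <- P].
Definition face (f : T) : graph T := cycle_of (face_seq f).
Definition translation_map : complex T := [set face f | f : T].

Local Notation K := translation_map.
Implicit Types (a c e f g u v w : T).

Hypothesis uniqP : uniq P.
Hypothesis sizeP : (3 < size P)%N.
Hypothesis diff_twice : forall a, a \in P ->
  exists c e, [/\ c \in P, e \in P, c != a & c + next P a = e + a].
Hypothesis sum_unique : forall a b c e,
  a \in P -> b \in P -> c \in P -> e \in P ->
  a + e = b + c -> a != b -> a != c -> neighbors P a c.
Hypothesis step_generates : exists2 a, a \in P &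
  forall t : T, exists k, t = (next P a - a) *+ k.

Lemma mem_face_seq v f : (v \in face_seq f) = (v + f \in P).
Proof. by rewrite -{1}(addrK f v) (mem_map (f := fun p => p - f)) //; apply: addIr. Qed.

Lemma mem_face v f : (v \in (face f).1) = (v + f \in P).
Proof. by rewrite inE mem_face_seq. Qed.

Lemma face_seq_uniq f : uniq (face_seq f).
Proof. by rewrite map_inj_uniq //; apply: addIr. Qed.

Lemma next_face_seq f v : next (face_seq f) v = next P (v + f) - f.
Proof.
by rewrite -{1}(addrK f v) /face_seq (next_map (h := fun p => p - f)) //; apply: addIr.
Qed.

Lemma face_neighbors f v w : neighbors (face_seq f) v w = neighbors P (v + f) (w + f).
Proof. by rewrite /neighbors !next_face_seq !subr_eq. Qed.

Lemma face_edge f v w : v + f \in P -> w + f \in P ->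
  neighbors P (v + f) (w + f) -> [set v; w] \in (face f).2.
Proof.
by move=> vP wP vw; apply: cycle_of_edge; rewrite ?mem_face_seq ?face_neighbors.
Qed.

Lemma size_face_seq f : size (face_seq f) = size P.
Proof. exact: size_map. Qed.

Lemma face_is_cycle f : is_cycle (face f).
Proof.
apply: is_cycle_cycle_of; first exact: face_seq_uniq.
by rewrite size_face_seq; apply: ltnW.
Qed.

Lemma face_simple f : simple_graph (face f).
Proof. by case: (face_is_cycle f). Qed.

(** This is [sum_unique] applied to [(v + f) + (w + g) = (v + g) + (w + f)]. *)
Lemma common_neighbors f g v w : f != g -> v != w ->
  v + f \in P -> v + g \in P -> w + f \in P -> w + g \in P ->
  neighbors P (v + f) (w + f).
Proof.
move=> fg vw vf vg wf wg; apply: (sum_unique vf vg wf wg).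
- by rewrite addrACA [RHS]addrACA (addrC g).
- by rewrite (inj_eq (addrI v)).
- by rewrite (inj_eq (addIr f)).
Qed.

(** Three common vertices would give three pairwise neighbouring terms of [P], which has more than
    three terms. *)
Lemma common_le2 f g u v w : f != g ->
  u + f \in P -> u + g \in P -> v + f \in P -> v + g \in P ->
  w + f \in P -> w + g \in P -> u != v -> v != w -> u != w -> False.
Proof.
move=> fg uf ug vf vg wf wg uv vw uw.
apply: (@neighbors_triangle _ P (u + f) (v + f) (w + f)) => //;
  rewrite ?(inj_eq (addIr f)) //; exact: (@common_neighbors f g).
Qed.

Lemma faceI_pair f g v w : f != g -> v != w ->
  v + f \in P -> v + g \in P -> w + f \in P -> w + g \in P ->
  (face f).1 :&: (face g).1 = [set v; w].
Proof.
move=> fg vw vf vg wf wg; apply/setP=> u; rewrite in_setI !mem_face !inE.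
apply/andP/orP => [[uf ug]|[]/eqP-> //].
have [_|uv] := eqVneq u v; first by left.
have [_|uw] := eqVneq u w; first by right.
by case: (@common_le2 f g u v w).
Qed.

Lemma faceI_single_edge f g v w : f != g -> v != w ->
  v + f \in P -> v + g \in P -> w + f \in P -> w + g \in P ->
  is_single_edge (graphI (face f) (face g)).
Proof.
move=> fg vw vf vg wf wg.
apply: (graphI_single_edge (@face_simple f) (@face_simple g) vw).
- exact: faceI_pair.
- by apply: face_edge => //; apply: (common_neighbors fg).
- by apply: face_edge => //; apply: (common_neighbors (f := g) (g := f)); rewrite // eq_sym.
Qed.

Lemma face_inj : injective face.
Proof.
move=> f g E; apply/eqP/negPn/negP => fg.
have Ev v : (v + f \in P) = (v + g \in P) by rewrite -!mem_face E.
have := face_seq_uniq f; have := sizeP; rewrite -(size_face_seq f).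
have mem v : v \in face_seq f -> v + f \in P /\ v + g \in P.
  by rewrite mem_face_seq -Ev.
case: (face_seq f) mem => [|u [|v [|w r]]] // mem _ /=.
rewrite !inE !negb_or => /and3P[/and3P[uv uw _] /andP[vw _] _].
have [uf ug] : u + f \in P /\ u + g \in P by apply: mem; rewrite !inE eqxx.
have [vf vg] : v + f \in P /\ v + g \in P by apply: mem; rewrite !inE eqxx orbT.
have [wf wg] : w + f \in P /\ w + g \in P by apply: mem; rewrite !inE eqxx !orbT.
by apply: (@common_le2 f g u v w).
Qed.

Lemma vertex_on_face v : exists f, v + f \in P.
Proof.
case: step_generates => a aP _; exists (a - v); by rewrite addrC subrK.
Qed.

Lemma vertices_map : vertices K = [set: T].
Proof.
apply/setP=> v; rewrite inE; apply/bigcupP.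
have [f fP] := vertex_on_face v.
by exists (face f); rewrite ?mem_face // imset_f.
Qed.

(** Symmetry of incidence: one sequence, [face_seq v], lists both the vertices of the face [v] and
    the indices of the faces through the vertex [v]. *)
Lemma faces_at_map v : faces_at K v =i map face (face_seq v).
Proof.
move=> G; rewrite inE; apply/andP/mapP => [[/imsetP[f _ ->]]|[f]].
  by rewrite mem_face addrC => fP; exists f; rewrite ?mem_face_seq.
by rewrite mem_face_seq addrC => fP ->; rewrite mem_face imset_f.
Qed.

Lemma polyhedral_complex_map : polyhedral_complex K.
Proof.
split=> [_ /imsetP[f _ ->]|_ _ /imsetP[f _ ->] /imsetP[g _ ->] fg].
  exact: face_is_cycle.
have {}fg : f != g by apply: contraNneq fg => ->.
have [le1|] := leqP #|(face f).1 :&: (face g).1| 1; last first.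
  case/card_gt1P=> v [w [+ + vw]]; rewrite !in_setI !mem_face.
  case/andP=> vf vg /andP[wf wg]; constructor 3.
  exact: (faceI_single_edge fg vw).
rewrite (graphI_le1 (@face_simple f) (@face_simple g) le1).
case: (set_0Vmem ((face f).1 :&: (face g).1)) => [->|[v vfg]]; first by constructor 1.
constructor 2; exists v; congr (_, _).
by apply/eqP; rewrite eq_sym eqEcard sub1set vfg cards1.
Qed.

Lemma consecutive_faces v f : f \in face_seq v ->
  let g := next (face_seq v) f in
  [/\ f != g, v + f \in P, v + g \in P
    & exists w, [/\ v != w, w + f \in P & w + g \in P]].
Proof.
move=> fs /=; have fP : v + f \in P by rewrite addrC -mem_face_seq.
split=> //.
- rewrite eq_sym next_neq ?face_seq_uniq // size_face_seq.
  by apply: leq_trans sizeP.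
- by rewrite addrC -mem_face_seq mem_next.
(* The repeated difference gives the second common vertex [c - f], at the term [c] for [f] and at
   [e] for the next face. *)
have [c [e [cP eP cvf E]]] := diff_twice fP.
exists (c - f); rewrite subrK; split=> //.
  by apply: contraNneq cvf => ->; rewrite subrK.
rewrite next_face_seq (addrC f) addrACA E.
by rewrite -opprD (addrC f) addrK.
Qed.

Lemma cyclic_face_order_map v : cyclic_face_order K v (map face (face_seq v)).
Proof.
split=> [|G|_ /mapP[f fs ->]].
- by rewrite (map_inj_uniq face_inj) face_seq_uniq.
- by rewrite faces_at_map.
rewrite (next_map face_inj) ?face_seq_uniq //.
have [fg fP gP [w [vw wf wg]]] := consecutive_faces fs.
exact: (faceI_single_edge fg vw).
Qed.

Lemma polyhedral_manifold_map : polyhedral_manifold K.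
Proof.
split=> [|v _]; first exact: polyhedral_complex_map.
exists (map face (face_seq v)); split.
- by rewrite !size_map; apply: ltnW.
- exact: cyclic_face_order_map.
rewrite -map_comp map_inj_in_uniq ?face_seq_uniq // => f h fs hs /=.
rewrite !(next_map face_inj) ?face_seq_uniq // => E.
have [fg fP gP [w [vw wf wg]]] := consecutive_faces fs.
have [hk hP kP _] := consecutive_faces hs.
have EV := congr1 fst E; rewrite /= in EV.
have : w \in (face h).1 :&: (face (next (face_seq v) h)).1.
  by rewrite -EV in_setI !mem_face wf wg.
rewrite in_setI !mem_face => /andP[wh wk].
set g := next (face_seq v) f in fg gP wg *.
set k := next (face_seq v) h in hk kP wk *.
(* [common_le2] with the roles of vertices and faces exchanged *)
have le2 a b c : a != b -> b != c -> a != c ->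
    v + a \in P -> v + b \in P -> v + c \in P ->
    w + a \in P -> w + b \in P -> w + c \in P -> False.
  rewrite ![v + _]addrC ![w + _]addrC => ab bc ac va vb vc wa wb wc.
  exact: (@common_le2 v w a b c).
(* All of [f], [g], [h], [k] contain [v] and [w]. If [f != h], then [g = h] and [k = f], a return
   after two steps among more than three faces. *)
apply/eqP/negPn/negP => fh.
have gh : g = h.
  by apply/eqP/negPn/negP => gh; apply: (le2 f g h).
have kf : k = f.
  by apply/eqP/negPn/negP => kf; apply: (le2 f h k); rewrite // eq_sym.
have := @iter_next_neq _ (face_seq v) f 2 (face_seq_uniq v) fs.
by rewrite /= -/g gh -/k kf eqxx size_face_seq => /(_ (ltnW sizeP)).
Qed.

(** The face [a - v] puts the two vertices at the consecutive terms [a] and [next P a]. *)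
Lemma adjacent_step a v : a \in P ->
  adjacent (edge_graph K) v (v + (next P a - a)).
Proof.
move=> aP; apply/bigcupP; exists (face (a - v)); first exact: imset_f.
have E x : v + x + (a - v) = a + x by rewrite addrCA [v + x]addrC addrK.
apply: face_edge; rewrite ?E.
- by rewrite addrC subrK.
- by rewrite addrC subrK mem_next.
by rewrite !(addrC _ (_ - _)) !subrK /neighbors eqxx.
Qed.

Lemma connected_map : connected_graph (edge_graph K).
Proof.
split=> [|v w _ _]; first by rewrite /= vertices_map; apply/set0Pn; exists 0; rewrite inE.
have [a aP gen] := step_generates.
have [k E] := gen (w - v).
have -> : w = v + (next P a - a) *+ k by rewrite -E addrC subrK.
elim: k {E} => [|k IH]; first by rewrite mulr0n addr0.
rewrite mulrSr addrA; apply: connect_trans IH (connect1 _).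
exact: adjacent_step.
Qed.

Lemma polyhedral_map_map : polyhedral_map K.
Proof. by split; [apply: polyhedral_manifold_map | apply: connected_map]. Qed.

Lemma equivelar_map : equivelar (size P) (size P) K.
Proof.
split=> [_ /imsetP[f _ ->]|v _].
  rewrite cardsE -(size_face_seq f); apply/card_uniqP; exact: face_seq_uniq.
rewrite (eq_card (faces_at_map v)) -(size_face_seq v) -(size_map face).
by apply/card_uniqP; rewrite (map_inj_uniq face_inj) face_seq_uniq.
Qed.

(** The dual allows any admissible order of the faces at [v], so all must give one cycle.
    Consecutive faces in [s] share [v] and another vertex, hence, by [common_neighbors] with
    vertices and faces exchanged, are neighbours in [face_seq v]; counting edges concludes. *)
Lemma cyclic_face_order_cycle v s :
  cyclic_face_order K v s -> cycle_of s = cycle_of (map face (face_seq v)).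
Proof.
case=> Us sE sh.
have sE' : s =i map face (face_seq v) by move=> G; rewrite sE faces_at_map.
have Uf : uniq (map face (face_seq v)).
  by rewrite (map_inj_uniq face_inj) face_seq_uniq.
have ss : size s = size (map face (face_seq v)) by apply: perm_size; apply: uniq_perm.
have s3 : (2 < size s)%N by rewrite ss !size_map; apply: ltnW.
have ssub : (cycle_of s).2 \subset (cycle_of (map face (face_seq v))).2.
  apply/subsetP=> _ /imsetP[F Fs ->].
  have nFs : next s F \in s by rewrite mem_next.
  have FnF := next_neq Us (ltnW s3) Fs.
  have [x [y [xy]]] := sh _ Fs.
  move: (Fs) (nFs) FnF; rewrite !sE'.
  case/mapP=> f fs -> /mapP[g gs ->] FnF /(congr1 fst) /= E.
  have [w wv wfg] : exists2 w, v != w & w \in (face f).1 :&: (face g).1.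
    rewrite E; have [->|] := eqVneq v x; first by exists y; rewrite // set22.
    by exists x; rewrite // set21.
  move: wfg fs gs; rewrite in_setI !mem_face !mem_face_seq => /andP[wf wg] fv gv.
  apply: cycle_of_edge; rewrite ?map_f ?mem_face_seq //.
  rewrite /neighbors !(next_map face_inj) ?face_seq_uniq // !(inj_eq face_inj).
  rewrite -/(neighbors (face_seq v) f g) face_neighbors.
  apply: (@common_neighbors v w f g) => //; rewrite 1?addrC //.
  by apply: contraNneq FnF => ->.
rewrite [LHS]surjective_pairing [RHS]surjective_pairing; congr (_, _).
  by apply/setP=> G; rewrite !inE sE'.
by apply/eqP; rewrite eqEcard ssub (card_cycle_of_edges Us s3) card_cycle_of_edges -?ss ?leqnn.
Qed.

Lemma dual_map : dual K = [set cycle_of (map face (face_seq v)) | v : T].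
Proof.
apply/setP=> C; rewrite inE; apply/asboolP/imsetP => [[v [s [_ so ->]]]|[v _ ->]].
  by exists v => //; apply: cyclic_face_order_cycle.
exists v, (map face (face_seq v)); split=> //; first by rewrite vertices_map.
exact: cyclic_face_order_map.
Qed.

Lemma vertices_dual_map : vertices (dual K) = [set face f | f : T].
Proof.
apply/setP=> G; apply/bigcupP/imsetP => [[C]|[f _ ->]].
  by rewrite dual_map => /imsetP[v _ ->]; rewrite inE => /mapP[f _ ->]; exists f.
have [v vP] := vertex_on_face f.
exists (cycle_of (map face (face_seq v))); first by rewrite dual_map imset_f.
by rewrite inE map_f // mem_face_seq.
Qed.

(** Left inverse of [face]; the default [0] only concerns graphs that are not faces. *)
Definition face_index (G : graph T) : T := odflt 0 [pick f | face f == G].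

Lemma faceK : cancel face face_index.
Proof.
move=> f; rewrite /face_index; case: pickP => [g /eqP /face_inj -> //|/(_ f)].
by rewrite eqxx.
Qed.

(** Sending [face f] to [f] turns the dual cycle around [v] into the cycle of [face_seq v], which is
    [face v]. *)
Lemma self_dual_map : self_dual K.
Proof.
exists face_index; rewrite vertices_dual_map vertices_map; split.
- by move=> _ _ /imsetP[f _ ->] /imsetP[g _ ->]; rewrite !faceK => ->.
- apply/setP=> f; rewrite inE; apply/imsetP; exists (face f); rewrite ?faceK //.
  exact: imset_f.
move=> s Us _ ssub; set t := map face_index s.
have Es : s = map face t.
  rewrite -map_comp -[LHS]map_id; apply/eq_in_map => G /ssub /imsetP[f _ ->] /=.
  by rewrite faceK.
have Ut : uniq t by rewrite -(map_inj_uniq face_inj) -Es.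
rewrite Es dual_map; split=> /imsetP[v _ E]; apply/imsetP; exists v => //.
  exact: cycle_of_map_inj face_inj Ut (face_seq_uniq v) E.
by rewrite !(cycle_of_map face_inj) ?face_seq_uniq // E.
Qed.

End TranslationMap.

(** * Partial sums of doubled superincreasing gaps *)

Section DoubledSuperincreasing.
Variable d : nat -> nat.

Definition psum i := \sum_(t < i) d t./2.

Hypothesis superincreasing : forall s, psum s.*2 < d s.

Lemma psum0 : psum 0 = 0.
Proof. by rewrite /psum big_ord0. Qed.

Lemma psumS i : psum i.+1 = psum i + d i./2.
Proof. by rewrite /psum big_ord_recr. Qed.

Lemma psum_odd s : psum s.*2.+1 = psum s.*2 + d s.
Proof. by rewrite psumS doubleK. Qed.

Lemma psum_even s : psum s.+1.*2 = psum s.*2 + (d s).*2.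
Proof. by rewrite doubleS psumS psum_odd (half_bit_double s true) -addnA addnn. Qed.

Lemma psum_lt : {homo psum : i j / i < j}.
Proof.
apply: homo_ltn ltn_trans _ => i.
by rewrite psumS -[ltnLHS]addn0 ltn_add2l (leq_ltn_trans _ (superincreasing _)).
Qed.

Lemma psum_le : {homo psum : i j / i <= j}.
Proof. by apply: ltnW_homo psum_lt. Qed.

Lemma psum_inj : injective psum.
Proof.
by move=> i j E; case: (ltngtP i j) => // /psum_lt; rewrite E ltnn.
Qed.

(** With [i] strictly the largest on its side, superincrease leaves [psum k + psum l] too small
    unless [psum j], [psum k], [psum i] are in progression across the two copies of one gap. *)
Lemma psum_collision i j k l : l <= k < i -> psum i + psum j = psum k + psum l ->
  i = k.+1 /\ l = k /\ l = j.+1.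
Proof.
case: i => [|i]; first by rewrite ltn0 andbF.
move=> /andP[lk ki]; rewrite ltnS in ki.
set s := i./2; have super := superincreasing s.
have Ei : i = odd i + s.*2 by rewrite odd_double_half.
case: (odd i) Ei => Ei; rewrite ?add0n ?add1n in Ei.
  have -> : i.+1 = s.+1.*2 by rewrite Ei.
  rewrite psum_even; have pk := psum_le ki; rewrite Ei psum_odd in pk.
  have [ls|ls] := leqP l s.*2.
    have := psum_le ls; lia.
  have El : l = s.*2.+1 by lia.
  have Ek : k = s.*2.+1 by lia.
  rewrite El Ek psum_odd => E.
  have /psum_inj -> : psum j = psum s.*2 by lia.
  lia.
rewrite Ei psum_odd; have := psum_le ki; have := psum_le (leq_trans lk ki).
rewrite Ei; lia.
Qed.

Lemma psum_collision_lt i j k l : k < i -> l < i -> psum i + psum j = psum k + psum l ->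
  i = k.+1 /\ l = k /\ l = j.+1.
Proof.
move=> ki li E; have [lk|/ltnW kl] := leqP l k.
  by apply: psum_collision; rewrite ?lk.
have := @psum_collision i j l k; rewrite kl li addnC => /(_ isT); lia.
Qed.

(** No index on one side occurs on the other, so the largest exceeds both opposite ones and
    [psum_collision_lt] applies: one side is a repeated index, the other its two neighbours. *)
Lemma psum_sidon i j k l : psum i + psum l = psum j + psum k ->
  i != j -> i != k -> (k == i.+1) || (i == k.+1).
Proof.
move=> E ij ik.
have lj : l != j.
  by apply: contra_eq_neq E => <-; rewrite addnC; apply/eqP=> /addnI /psum_inj; lia.
have lk : l != k.
  by apply: contra_eq_neq E => <-; apply/eqP=> /addIn /psum_inj; lia.
have [li|il] := leqP l i; have [kj|jk] := leqP k j.
- have [ji|ji] := ltnP j i.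
    have := @psum_collision_lt i l j k; lia.
  have := @psum_collision_lt j k i l; lia.
- have [ki|ki] := ltnP k i.
    have := @psum_collision_lt i l j k; lia.
  have := @psum_collision_lt k j i l; lia.
- have [jl|jl] := ltnP j l.
    have := @psum_collision_lt l i j k; lia.
  have := @psum_collision_lt j k i l; lia.
- have [kl|kl] := ltnP k l.
    have := @psum_collision_lt l i j k; lia.
  have := @psum_collision_lt k j i l; lia.
Qed.

End DoubledSuperincreasing.

Lemma eqn_mod_lt_double a b N : a < N.*2 -> b < N.*2 ->
  a = b %[mod N] -> [\/ a = b, a = b + N | b = a + N].
Proof.
move=> aN bN; wlog ba : a b aN bN / b <= a => [W E|].
  have [ba|/ltnW ab] := leqP b a; first exact: W.
  by case: (W b a bN aN ab (esym E)) => ?; [constructor 1|constructor 3|constructor 2].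
move/eqP; rewrite eqn_mod_dvd // => /dvdnP[[|[|k]] E].
- by constructor 1; lia.
- by constructor 2; lia.
- by constructor 1; nia.
Qed.

Lemma next_map_iota (T : eqType) (x : nat -> T) q i :
  uniq [seq x j | j <- iota 0 q] -> i < q ->
  next [seq x j | j <- iota 0 q] (x i) = x (if i.+1 < q then i.+1 else 0).
Proof.
case: q => // q Ux iq; rewrite next_nth map_f ?mem_iota //.
have -> : index (x i) [seq x j | j <- iota 0 q.+1] = i.
  have {1}-> : x i = nth (x 0) [seq x j | j <- iota 0 q.+1] i.
    by rewrite (nth_map 0) ?size_iota // nth_iota.
  by rewrite index_uniq // size_map size_iota.
rewrite ltnS /=; case: ltnP => iq'; last by rewrite nth_default // size_map size_iota.
by rewrite (nth_map 0) ?size_iota // nth_iota.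
Qed.

(** * From index arithmetic to maps over a cyclic group *)

Section CyclicMap.
Local Open Scope ring_scope.
Variables (d : nat -> nat) (N q : nat).
Local Notation p := (psum d).
Hypothesis superincreasing : forall s, (p s.*2 < d s)%N.
Hypothesis d0 : d 0%N = 1%N.
Hypothesis q_gt3 : (3 < q)%N.
Hypothesis p_lt : forall i, (i < q)%N -> (p i < N.+1)%N.

(** The group is ['I_N.+1], so [N] is the predecessor of its order, the vertex count. *)
Definition residue i : 'I_N.+1 := inZp (p i).
Definition base_seq := [seq residue i | i <- iota 0 q].

Lemma inZpD i j : inZp i + inZp j = inZp (i + j)%N :> 'I_N.+1.
Proof. by apply: val_inj; rewrite /= modnDm. Qed.

Lemma residueD_eq i j k l : residue i + residue j = residue k + residue l <->
  (p i + p j = p k + p l %[mod N.+1])%N.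
Proof.
rewrite /residue !inZpD; split=> [/(congr1 val) //|E]; exact: val_inj.
Qed.

Lemma residue_inj : {in iota 0 q &, injective residue}.
Proof.
move=> i j; rewrite !mem_iota /= => iq jq /(congr1 val) /=.
by rewrite !modn_small ?p_lt // => /(psum_inj superincreasing).
Qed.

Lemma residue_eq i j : (i < q)%N -> (j < q)%N -> (residue i == residue j) = (i == j).
Proof. by move=> iq jq; rewrite (inj_in_eq residue_inj) ?mem_iota. Qed.

Lemma base_seq_uniq : uniq base_seq.
Proof. by rewrite (map_inj_in_uniq residue_inj) iota_uniq. Qed.

Lemma mem_residue i : (i < q)%N -> residue i \in base_seq.
Proof. by move=> iq; rewrite map_f // mem_iota. Qed.

Lemma residueP a : reflect (exists2 i, (i < q)%N & a = residue i) (a \in base_seq).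
Proof.
apply: (iffP mapP) => [[i]|[i iq ->]]; first by rewrite mem_iota => iq ->; exists i.
by exists i; rewrite // mem_iota.
Qed.

Lemma next_residue i : (i < q)%N ->
  next base_seq (residue i) = residue (if (i.+1 < q)%N then i.+1 else 0%N).
Proof. exact: (next_map_iota base_seq_uniq). Qed.

Lemma residue_neighbors i k : (i < q)%N -> (k < q)%N ->
  [\/ k = i.+1, i = k.+1, i = q.-1 /\ k = 0%N | k = q.-1 /\ i = 0%N] ->
  neighbors base_seq (residue i) (residue k).
Proof.
move=> iq kq; rewrite /neighbors !next_residue // => -[E|E|[E1 E2]|[E1 E2]].
- by rewrite -E kq eqxx.
- by rewrite -E iq eqxx orbT.
- by rewrite E1 prednK ?ltnn ?E2 ?eqxx //; lia.
- by rewrite E1 prednK ?ltnn ?E2 ?eqxx ?orbT //; lia.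
Qed.

Hypothesis diff_twice : forall i, (i < q)%N -> exists c e,
  [/\ (c < q)%N, (e < q)%N, c != i &
      residue c + next base_seq (residue i) = residue e + residue i].
Hypothesis sum_unique : forall i j k l,
  (i < q)%N -> (j < q)%N -> (k < q)%N -> (l < q)%N ->
  (p i + p l = p j + p k %[mod N.+1])%N -> i != j -> i != k ->
  [\/ k = i.+1, i = k.+1, i = q.-1 /\ k = 0%N | k = q.-1 /\ i = 0%N].

Lemma cyclic_map_exists : exists (T : finType) (K : complex T),
  [/\ polyhedral_map K, equivelar q q K, self_dual K & #|vertices K| = N.+1].
Proof.
have sz : size base_seq = q by rewrite size_map size_iota.
have size3 : (3 < size base_seq)%N by rewrite sz.
have dt a : a \in base_seq -> exists c e, [/\ c \in base_seq, e \in base_seq,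
    c != a & c + next base_seq a = e + a].
  case/residueP=> i iq ->; have [c [e [cq eq ci E]]] := diff_twice iq.
  by exists (residue c), (residue e); rewrite residue_eq // !mem_residue.
have su a b c e : a \in base_seq -> b \in base_seq -> c \in base_seq ->
    e \in base_seq -> a + e = b + c -> a != b -> a != c -> neighbors base_seq a c.
  case/residueP=> i iq -> /residueP[j jq ->] /residueP[k kq ->] /residueP[l lq ->].
  move=> /residueD_eq E; rewrite !residue_eq // => ij ik.
  by apply: residue_neighbors => //; apply: (sum_unique iq jq kq lq).
have gen : exists2 a, a \in base_seq & forall t, exists k, t = (next base_seq a - a) *+ k.
  exists (residue 0%N); first by apply: mem_residue; lia.
  (* The first step is [d 0 = 1], so [t] itself, read as a number, is the multiplicity. *)
  move=> t; exists t; rewrite next_residue ?ifT; try lia.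
  rewrite /residue psumS psum0 d0 (_ : inZp 0 = 0) ?subr0; last exact: val_inj.
  rewrite -[LHS]valZpK; elim: (t : nat) => [|k IH]; first by apply: val_inj.
  by rewrite mulrSr -IH inZpD add0n addn1.
have US := base_seq_uniq.
exists _, (translation_map base_seq); split.
- exact: (polyhedral_map_map US).
- by rewrite -{1 2}sz; apply: (equivelar_map US).
- exact: (self_dual_map US).
by rewrite (vertices_map gen) cardsT card_ord.
Qed.

End CyclicMap.

(** * The even case modulo [p m.*2] and the odd case modulo its double *)

Section TwoParities.
Variables (d : nat -> nat) (m : nat).
Local Notation p := (psum d).
Hypothesis superincreasing : forall s, p s.*2 < d s.
Hypothesis d0 : d 0 = 1.

Lemma even_map_exists : 2 < m -> exists (T : finType) (K : complex T),
  [/\ polyhedral_map K, equivelar m.*2 m.*2 K, self_dual K & #|vertices K| = p m.*2].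
Proof.
move=> m2.
have N0 : 0 < p m.*2 by rewrite -(psum0 d) psum_lt //; lia.
have pN : (p m.*2).-1.+1 = p m.*2 by rewrite prednK.
have plt i : i < m.*2 -> p i < (p m.*2).-1.+1 by rewrite pN; apply: psum_lt.
have pm : p m.*2 = p m.-1.*2 + (d m.-1).*2 by rewrite -psum_even prednK //; lia.
have super := superincreasing m.-1.
rewrite -pN; apply: (@cyclic_map_exists d) => //; first lia.
- move=> i im.
  (* The modulus is [p m.*2], so index [m.*2] stands for index [0] and wrapping around is passing to
     [i.+1]. *)
  have res0 : residue d (p m.*2).-1 m.*2 = residue d _ 0.
    by apply: val_inj; rewrite /= pN modnn psum0 mod0n.
  have -> : next (base_seq d (p m.*2).-1 m.*2) (residue d _ i) = residue d _ i.+1.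
    rewrite next_residue //; case: ltnP => // im'.
    by have -> : i.+1 = m.*2 by lia.
  (* Each gap is crossed twice in a row: the other crossing starts at [i.-1] if [i] is odd and at
     [i.+1] if [i] is even. *)
  have Ei : i = odd i + i./2.*2 by rewrite odd_double_half.
  case: (odd i) Ei => Ei; rewrite ?add0n ?add1n in Ei.
    exists i.-1, i; split; try lia.
    by apply/residueD_eq; rewrite Ei -doubleS /= psum_even psum_odd; congr modn; lia.
  exists i.+1, (if i.+2 < m.*2 then i.+2 else 0); split; try lia.
    by case: ifP => //; lia.
  have -> : residue d (p m.*2).-1 (if i.+2 < m.*2 then i.+2 else 0) = residue d _ i.+2.
    by case: ltnP => // im'; have -> : i.+2 = m.*2 by lia.
  by apply/residueD_eq; rewrite Ei -doubleS psum_even psum_odd; congr modn; lia.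
(* An excess of a full modulus needs both [p i] and [p l] above [p m.*2.-2], so [i] and [l] are the
   last index and [p j + p k = p m.*2.-2]. *)
have last_pair i j k l : i < m.*2 -> j < m.*2 -> k < m.*2 -> l < m.*2 ->
    p i + p l = p j + p k + p m.*2 ->
    [/\ i = m.*2.-1, l = m.*2.-1 & (k == 0) || (k == m.*2.-2)].
  move=> im jm km lm E.
  have Em : m.-1.*2 = m.*2.-2 by lia.
  have top h : h < m.*2 -> (h = m.*2.-1 /\ p h = p m.-1.*2 + d m.-1) \/ p h <= p m.-1.*2.
    move=> hm; have [hs|hl] := leqP h m.-1.*2; [right; exact: psum_le | left].
    by have -> : h = m.-1.*2.+1 by [lia]; rewrite psum_odd; split; lia.
  have [[ei pi]|pi] := top i im; have [[el pl]|pl] := top l lm; try lia.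
  split=> //; have Ejk : p k + p j = p 0 + p m.*2.-2 by rewrite psum0 -Em; lia.
  (* Were [k] neither [0] nor [m.*2.-2], then [psum_sidon], used with both orders of the right side,
     would make [k] adjacent to both, against [2 < m]. *)
  have := psum_sidon superincreasing Ejk; rewrite addnC in Ejk.
  have := psum_sidon superincreasing (etrans (addnC _ _) (etrans Ejk (addnC _ _))).
  lia.
move=> i j k l im jm km lm; rewrite pN => /eqn_mod_lt_double[].
- by have := psum_lt superincreasing im; have := psum_lt superincreasing lm; lia.
- by have := psum_lt superincreasing jm; have := psum_lt superincreasing km; lia.
- move=> E ij ik; have := psum_sidon superincreasing E ij ik.
  by case/orP=> /eqP; [constructor 1 | constructor 2].
- case/(last_pair _ _ _ _ im jm km lm) => -> _ /orP[]/eqP-> _ _; first by constructor 3.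
  by constructor 2; lia.
rewrite [p j + _]addnC [p i + _]addnC.
case/(last_pair k l i j km lm im jm) => -> _ /orP[]/eqP-> _ _; first by constructor 4.
by constructor 1; lia.
Qed.

Lemma odd_map_exists : 1 < m -> exists (T : finType) (K : complex T),
  [/\ polyhedral_map K, equivelar m.*2.+1 m.*2.+1 K, self_dual K
    & #|vertices K| = (p m.*2).*2].
Proof.
move=> m1.
have N0 : 0 < p m.*2 by rewrite -(psum0 d) psum_lt //; lia.
have pN : (p m.*2).*2.-1.+1 = (p m.*2).*2 by lia.
have ple i : i < m.*2.+1 -> p i <= p m.*2 by rewrite ltnS; apply: psum_le.
rewrite -pN; apply: (@cyclic_map_exists d) => //; first lia.
- by move=> i /ple; lia.
- move=> i; rewrite ltnS leq_eqVlt => /orP[/eqP->|im].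
    (* The closing difference [- p m.*2] has order two, so it recurs from index [0] to index
       [m.*2]. *)
    exists 0, m.*2; split; try lia.
    rewrite next_residue ?ltnn //.
      by apply/residueD_eq; rewrite psum0 pN [p _ + p _]addnn modnn mod0n.
    by move=> j /ple; lia.
  rewrite next_residue ?ltnS ?im //; [|by move=> j /ple; lia|lia].
  have Ei : i = odd i + i./2.*2 by rewrite odd_double_half.
  case: (odd i) Ei => Ei; rewrite ?add0n ?add1n in Ei.
    exists i.-1, i; split; try lia.
    by apply/residueD_eq; rewrite Ei -doubleS /= psum_even psum_odd; congr modn; lia.
  exists i.+1, i.+2; split; try lia.
  by apply/residueD_eq; rewrite Ei -doubleS psum_even psum_odd; congr modn; lia.
(* An excess of the full modulus is possible only for extreme values: [p i = p l = p m.*2] and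
   [p j = p k = 0]. *)
have extremes i j k l : i < m.*2.+1 -> j < m.*2.+1 -> k < m.*2.+1 -> l < m.*2.+1 ->
    p i + p l = p j + p k + (p m.*2).*2 -> i = m.*2 /\ k = 0.
  move=> /ple im _ _ /ple lm E; split; apply: (psum_inj superincreasing); rewrite ?psum0; lia.
move=> i j k l im jm km lm; rewrite pN => /eqn_mod_lt_double[].
- by have := ple _ im; have := ple _ lm; lia.
- by have := ple _ jm; have := ple _ km; lia.
- move=> E ij ik; have := psum_sidon superincreasing E ij ik.
  by case/orP=> /eqP; [constructor 1 | constructor 2].
- case/(extremes _ _ _ _ im jm km lm) => -> -> _ _; by constructor 3.
rewrite [p j + _]addnC [p i + _]addnC.
by case/(extremes k l i j km lm im jm) => -> -> _ _; constructor 4.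
Qed.

End TwoParities.

(** * Gaps built from powers of 3 *)

Section Gaps.
Variables n r : nat.

(* Only the gaps [s <= r] are used; the later ones merely keep the sequence
   superincreasing without side condition. *)
Definition gap s := 3 ^ s + (if r <= s then n * 3 ^ (s - r) else 0).

(** Two geometric sums: [2 * (1 + 3 + ... + 3 ^ (s - 1)) = 3 ^ s - 1], and likewise from [r] on;
    truncated subtraction kills the second for [s <= r]. *)
Lemma psum_gap s : psum gap s.*2 = (3 ^ s - 1) + n * (3 ^ (s - r) - 1).
Proof.
elim: s => [|s IH]; first by rewrite psum0 muln0.
have X0 : 0 < 3 ^ s by rewrite expn_gt0.
have Y0 : 0 < 3 ^ (s - r) by rewrite expn_gt0.
rewrite psum_even IH /gap expnS; have [rs|rs] := leqP r s.
  by rewrite subSn // expnS; nia.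
have -> : s - r = 0 by lia.
have -> : s.+1 - r = 0 by lia.
rewrite expn0; lia.
Qed.

Lemma gap_superincreasing s : psum gap s.*2 < gap s.
Proof.
have X0 : 0 < 3 ^ s by rewrite expn_gt0.
have Y0 : 0 < 3 ^ (s - r) by rewrite expn_gt0.
rewrite psum_gap /gap; have [rs|rs] := leqP r s; first by nia.
have -> : s - r = 0 by lia.
rewrite expn0; lia.
Qed.

Lemma psum_gap_last : psum gap r.+1.*2 = 3 ^ r.+1 - 1 + 2 * n.
Proof. by rewrite psum_gap subSn // subnn expn1 mulnC. Qed.

Lemma gap0 : 0 < r -> gap 0 = 1.
Proof. by rewrite /gap; case: r. Qed.

End Gaps.

Theorem theorem1 (m n : nat) (hm : 3 <= m) :
  (exists (T : finType) (K : complex T),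
    [/\ polyhedral_map K, equivelar (2 * m - 1) (2 * m - 1) K, self_dual K
      & #|vertices K| = 2 * (3 ^ (m - 1) + 2 * n - 1)]) /\
  (exists (T : finType) (K : complex T),
    [/\ polyhedral_map K, equivelar (2 * m) (2 * m) K, self_dual K
      & #|vertices K| = 3 ^ m + 2 * n - 1]).
Proof.
case: m hm => [|[|[|r]]] // _; split.
  have r0 : 0 < r.+1 by [].
  (* With [m = r.+3], the odd case takes [m - 1] doubled gaps, as [2 * (m - 1) + 1 = 2 * m - 1]; the
     increased gap is the last, of index [r.+1]. *)
  have := @odd_map_exists _ r.+2 (gap_superincreasing n r.+1) (gap0 n r0) isT.
  have -> : 2 * r.+3 - 1 = r.+2.*2.+1 by lia.
  have -> : r.+3 - 1 = r.+2 by lia.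
  rewrite psum_gap_last.
  have X0 : 0 < 3 ^ r.+2 by rewrite expn_gt0.
  by have -> : 2 * (3 ^ r.+2 + 2 * n - 1) = (3 ^ r.+2 - 1 + 2 * n).*2 by [lia].
have r0 : 0 < r.+2 by [].
(* Here [m] doubled gaps are used, the last of index [r.+2]. *)
have := @even_map_exists _ r.+3 (gap_superincreasing n r.+2) (gap0 n r0) isT.
rewrite mul2n psum_gap_last.
have X0 : 0 < 3 ^ r.+3 by rewrite expn_gt0.
by have -> : 3 ^ r.+3 + 2 * n - 1 = 3 ^ r.+3 - 1 + 2 * n by lia.
Qed.
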